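(* Let $X$ be a smooth manifold of odd dimension $n$ with a 1-form $\eta$ such that $\omega=d\eta$ is non-degenerate on $D=\ker\eta$, and let $\vec\xi$ be the Reeb vector field of $\eta$. The notion of an almost contact metric structure in the new sense is equivalent to the notion of an almost contact metric structure in the old sense. That is: (1) if $(\varphi,\vec\xi,\eta,\tilde g)$ is an almost contact metric structure in the old sense on $X$, then $\varphi$ together with the admissible tensor field $g$ determined by $g(\vec u,\vec v)=\tilde g(\vec u,\vec v)$ for sections $\vec u,\vec v$ of $D$ is an almost contact metric structure in the new sense; (2) if $(\varphi,g)$ is an almost contact metric structure in the new sense on $(X,\eta)$ and $\tilde g$ is the metric on $X$ defined by $\tilde g(\vec u,\vec v)=g(\vec u,\vec v)$, $\tilde g(\vec u,\vec\xi)=0$, $\tilde g(\vec\xi,\vec\xi)=1$ for sections $\vec u,\vec v$ of $D$, then $(\varphi,\vec\xi,\eta,\tilde g)$ is an almost contact metric structure in the old sense; and these two assignments are inverse to each other.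
   Context: All objects are $C^\infty$. The Reeb vector field $\vec\xi$ is the unique vector field with $\eta(\vec\xi)=1$ and $\ker\omega=\mathrm{span}(\vec\xi)$. Write $D^\perp=\mathrm{span}(\vec\xi)$, so $TX=D\oplus D^\perp$. A tensor field is admissible (to $D$) if it vanishes whenever one of its vector arguments belongs to $D^\perp$ or one of its covector arguments is proportional to $\eta$. In particular an admissible $(1,1)$-tensor field $\varphi$ satisfies $\varphi(\vec\xi)=0$ and $\eta\circ\varphi=0$, and an admissible $(0,2)$-tensor field is determined by its restriction to $D$. Old sense: an almost contact metric structure is a tuple $(\varphi,\vec\xi,\eta,\tilde g)$, where $\varphi$ is a $(1,1)$-tensor field, $\vec\xi$ a vector field, $\eta$ a 1-form and $\tilde g$ a (pseudo-)Riemannian metric on $X$, such that $\eta(\vec\xi)=1$, $\varphi(\vec\xi)=0$, $\eta\circ\varphi=0$, $\varphi^2\vec X=-\vec X+\eta(\vec X)\vec\xi$ and $\tilde g(\varphi\vec X,\varphi\vec Y)=\tilde g(\vec X,\vec Y)-\eta(\vec X)\eta(\vec Y)$ for all vector fields $\vec X,\vec Y$ on $X$. As a standing assumption, $\vec\xi$ is the Reeb vector field of $\eta$. New sense: given $\eta$, an almost contact metric structure is a pair $(\varphi,g)$ of admissible tensor fields, where $\varphi$ is of type $(1,1)$ and $g$ is of type $(0,2)$, symmetric, and restricts to a (pseudo-)Riemannian fibre metric on $D$, such that $\varphi^2\vec u=-\vec u$ and $g(\varphi\vec u,\varphi\vec v)=g(\vec u,\vec v)$ for all sections $\vec u,\vec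 v$ of $D$. *)

(* Defs.v *)
From mathcomp Require Import all_boot all_order all_algebra.
From mathcomp Require Import all_classical all_reals all_analysis.
Import Order.TTheory GRing.Theory Num.Theory.
Import numFieldNormedType.Exports.

Set Implicit Arguments.
Unset Strict Implicit.
Unset Printing Implicit Defensive.

Local Open Scope classical_set_scope.
Local Open Scope ring_scope.

Section SmoothMaps.
Variables (R : realType) (V W : normedModType R).

(* Used with [U] open: [differentiable] is Frechet differentiability and
   ['D_v f] is the directional derivative.  [Ck k U f] lies between class
   C^(k+1) and class C^k on [U], so that for all k together it is C^oo. *)
Fixpoint Ck (k : nat) (U : set V) (f : V -> W) : Prop :=
  match k with
  | 0 => forall x, U x -> {for x, continuous f}
  | k'.+1 => (forall x, U x -> differentiable f x) /\
             (forall v, Ck k' U ('D_v f))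
  end.

Definition smooth_on (U : set V) (f : V -> W) : Prop := forall k, Ck k U f.

End SmoothMaps.

(* [cmap] and [cinv] are total functions, meaningful on [cdom] and
   [cmap @` cdom] only. *)
Record chart (R : realType) (n : nat) (X : topologicalType) := Chart {
  cdom : set X;
  cmap : X -> 'rV[R]_n;
  cinv : 'rV[R]_n -> X;
  open_cdom : open cdom;
  open_cimg : open (cmap @` cdom);
  cmapK : forall p, cdom p -> cinv (cmap p) = p;
  continuous_cmap : forall p, cdom p -> {for p, continuous cmap};
  continuous_cinv : forall x, (cmap @` cdom) x -> {for x, continuous cinv} }.

Definition cimg (R : realType) (n : nat) (X : topologicalType)
  (c : chart R n X) : set 'rV[R]_n := cmap c @` cdom c.

Record manifold (R : realType) (n : nat) := Manifold {
  msort :> topologicalType;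
  manifold_hausdorff : hausdorff_space msort;
  manifold_second_countable : @second_countable msort;
  atlas : set (chart R n msort);
  chart_at : msort -> chart R n msort;
  atlas_chart_at : forall p, atlas (chart_at p);
  cdom_chart_at : forall p, cdom (chart_at p) p;
  atlas_compatible : forall c c', atlas c -> atlas c' ->
    smooth_on (cmap c @` (cdom c `&` cdom c')) (cmap c' \o cinv c) }.

Section Tensors.
Variables (R : realType) (n : nat) (X : manifold R n).

(* A tangent vector at [p] is a class of pairs (chart around p, coordinate
   vector), where two pairs are identified when the differential of the
   transition map exchanges the coordinate vectors.  T_p X is represented by
   ['rV[R]_n] through the coordinate vector in the chart [chart_at p].
   Accordingly the values at [p] of tensor fields are matrices: the covector
   [a : 'cV_n] maps [u] to [u *m a], the endomorphism [A : 'M_n] maps [u] to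
   [u *m A], and the bilinear form [B : 'M_n] maps [(u, v)] to
   [u *m B *m v^T].  Since [chart_at p] need not depend continuously on [p],
   smoothness is expressed through the components in every chart. *)
Definition vfield := X -> 'rV[R]_n.
Definition form1 := X -> 'cV[R]_n.
Definition tensor11 := X -> 'M[R]_n.
Definition tensor02 := X -> 'M[R]_n.

Definition pairing (a : 'cV[R]_n) (u : 'rV[R]_n) : R := (u *m a) 0 0.
Definition bilin (B : 'M[R]_n) (u v : 'rV[R]_n) : R := (u *m B *m v^T) 0 0.

(* The coordinate vector d/dx_j of the chart [c], at the point [q]. *)
Definition coord_vec (c : chart R n X) (j : 'I_n) (q : X) : 'rV[R]_n :=
  'D_(delta_mx 0 j) (cmap (chart_at q) \o cinv c) (cmap c q).

(* The coordinates in the chart [c] of the tangent vector [u] at [q]. *)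
Definition coords (c : chart R n X) (q : X) (u : 'rV[R]_n) : 'rV[R]_n :=
  'D_u (cmap c \o cinv (chart_at q)) (cmap (chart_at q) q).

Definition smooth_vfield (xi : vfield) : Prop := forall c, atlas c ->
  smooth_on (cimg c) (fun x => coords c (cinv c x) (xi (cinv c x))).

Definition form1_coef (eta : form1) (c : chart R n X) (j : 'I_n)
    (x : 'rV[R]_n) : R :=
  pairing (eta (cinv c x)) (coord_vec c j (cinv c x)).

Definition smooth_form1 (eta : form1) : Prop := forall c j, atlas c ->
  smooth_on (cimg c) (form1_coef eta c j : 'rV[R]_n -> R^o).

Definition smooth_tensor11 (phi : tensor11) : Prop := forall c j, atlas c ->
  smooth_on (cimg c) (fun x =>
    coords c (cinv c x) (coord_vec c j (cinv c x) *m phi (cinv c x))).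

Definition smooth_tensor02 (g : tensor02) : Prop := forall c i j, atlas c ->
  smooth_on (cimg c) ((fun x =>
    bilin (g (cinv c x)) (coord_vec c i (cinv c x))
                         (coord_vec c j (cinv c x))) : 'rV[R]_n -> R^o).

(* (d eta)_ij = d_i eta_j - d_j eta_i in the chart [chart_at p], in which the
   coordinates of [u] and [v] are their entries. *)
Definition dform (eta : form1) : tensor02 := fun p =>
  let c := chart_at p in
  \matrix_(i, j)
    ('D_(delta_mx 0 i) (form1_coef eta c j : 'rV[R]_n -> R^o) (cmap c p)
     - 'D_(delta_mx 0 j) (form1_coef eta c i : 'rV[R]_n -> R^o) (cmap c p)).

Definition Dker (eta : form1) (p : X) : set 'rV[R]_n :=
  [set u | pairing (eta p) u = 0].

Definition line (xi : vfield) (p : X) : set 'rV[R]_n :=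
  [set u | exists a : R, u = a *: xi p].

Definition nondegenerate_on (E : set 'rV[R]_n) (B : 'M[R]_n) : Prop :=
  forall u, E u -> (forall v, E v -> bilin B u v = 0) -> u = 0.

Definition is_reeb (eta : form1) (xi : vfield) : Prop :=
  [/\ smooth_vfield xi,
      forall p, pairing (eta p) (xi p) = 1 &
      forall p, [set u | forall v, bilin (dform eta p) u v = 0] = line xi p].

Inductive metric_kind := Riemannian | PseudoRiemannian.

Definition fibre_metric (k : metric_kind) (E : set 'rV[R]_n) (B : 'M[R]_n) :
    Prop :=
  (forall u v, E u -> E v -> bilin B u v = bilin B v u) /\
  match k with
  | Riemannian => forall u, E u -> u <> 0 -> 0 < bilin B u u
  | PseudoRiemannian => nondegenerate_on E B
  end.

Definition symmetric_tensor (g : tensor02) : Prop :=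
  forall p u v, bilin (g p) u v = bilin (g p) v u.

Definition admissible11 (eta : form1) (xi : vfield) (phi : tensor11) : Prop :=
  forall p (u : 'rV[R]_n) (a : 'cV[R]_n),
    line xi p u \/ (exists b : R, a = b *: eta p) ->
    pairing a (u *m phi p) = 0.

Definition admissible02 (xi : vfield) (g : tensor02) : Prop :=
  forall p (u v : 'rV[R]_n), line xi p u \/ line xi p v -> bilin (g p) u v = 0.

Record acm_old (k : metric_kind) (phi : tensor11) (xi : vfield) (eta : form1)
    (gt : tensor02) : Prop := AcmOld {
  old_smooth_phi : smooth_tensor11 phi;
  old_smooth_eta : smooth_form1 eta;
  old_reeb : is_reeb eta xi;
  old_smooth_metric : smooth_tensor02 gt;
  old_metric : forall p, fibre_metric k setT (gt p);
  old_eta_xi : forall p, pairing (eta p) (xi p) = 1;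
  old_phi_xi : forall p, xi p *m phi p = 0;
  old_eta_phi : forall p u, pairing (eta p) (u *m phi p) = 0;
  old_phi2 : forall p u,
    u *m phi p *m phi p = - u + pairing (eta p) u *: xi p;
  old_compat : forall p u v,
    bilin (gt p) (u *m phi p) (v *m phi p) =
    bilin (gt p) u v - pairing (eta p) u * pairing (eta p) v }.

Record acm_new (k : metric_kind) (eta : form1) (xi : vfield)
    (phi : tensor11) (g : tensor02) : Prop := AcmNew {
  new_smooth_phi : smooth_tensor11 phi;
  new_admissible_phi : admissible11 eta xi phi;
  new_smooth_metric : smooth_tensor02 g;
  new_admissible_metric : admissible02 xi g;
  new_symmetric : symmetric_tensor g;
  new_metric : forall p, fibre_metric k (Dker eta p) (g p);
  new_phi2 : forall p u, Dker eta p u -> u *m phi p *m phi p = - u;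
  new_compat : forall p u v, Dker eta p u -> Dker eta p v ->
    bilin (g p) (u *m phi p) (v *m phi p) = bilin (g p) u v }.

Definition restriction_of (eta : form1) (xi : vfield) (gt g : tensor02) : Prop :=
  [/\ smooth_tensor02 g, admissible02 xi g &
      forall p u v, Dker eta p u -> Dker eta p v ->
        bilin (g p) u v = bilin (gt p) u v].

Definition extension_of (eta : form1) (xi : vfield) (g gt : tensor02) : Prop :=
  [/\ smooth_tensor02 gt, symmetric_tensor gt,
      forall p u v, Dker eta p u -> Dker eta p v ->
        bilin (gt p) u v = bilin (g p) u v,
      forall p u, Dker eta p u -> bilin (gt p) u (xi p) = 0 &
      forall p, bilin (gt p) (xi p) (xi p) = 1].

End Tensors.

(* Main.v *)
Require Import Defs.
From mathcomp Require Import all_boot all_order all_algebra.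
From mathcomp Require Import all_classical all_reals all_analysis.
Import Order.TTheory GRing.Theory Num.Theory.
Import numFieldNormedType.Exports.

(** The two senses differ only by the tensor [eta (x) eta]: both assignments are
    given by the formula [gt = g + eta (x) eta].

    On the new side, [g] vanishes along [xi] and [eta] vanishes on [D], so
    [g + eta (x) eta] agrees with [g] on [D], makes [xi] a unit vector and makes
    [xi] orthogonal to [D]; it is the extension ([add_square_extension]).  On
    the old side, substituting [xi] into the compatibility condition and using
    [phi xi = 0] gives [gt (u, xi) = eta u] ([old_metric_reeb]), so that
    [gt - eta (x) eta] kills [xi] and agrees with [gt] on [D]; it is the
    restriction ([sub_square_restriction]).  These formulas use neither frames
    of [D] nor projections, and therefore give the smoothness at once: what is
    needed is that sums and products of smooth functions on an open set are
    smooth ([Ck_add], [Ck_mul]).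

    Uniqueness, on either side, holds because [T = D + span xi] and a bilinear
    form is determined by its blocks for this splitting ([bilin_split_ext]).
    The same splitting carries over the remaining axioms: it makes [D] and [xi]
    [gt]-orthogonal, so [gt] is positive definite or nondegenerate exactly when
    [g] is so on [D] ([fibre_metric_restrict], [fibre_metric_extend]), and
    [phi] kills the [xi]-component, so identities for [phi] on [D] extend to
    [T].

    That the assignments are mutually inverse follows from uniqueness: if [g]
    is the restriction of an old metric [gt], then [gt] is an extension of [g]
    ([old_extension_of_restriction]), and the converse is immediate. *)

Set Implicit Arguments.
Unset Strict Implicit.
Unset Printing Implicit Defensive.

Local Open Scope classical_set_scope.
Local Open Scope ring_scope.

(** * Calculus of smooth functions on an open set *)

Section SmoothFunctions.
Context {R : realType} {V : normedModType R}.

(** The first-order expansion of [f] at [x] is also one of [g], as it only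
    involves values near [x]. *)
Lemma near_eq_differentiable (W : normedModType R) (f g : V -> W) (x : V) :
  (\near x, f x = g x) -> differentiable f x -> differentiable g x.
Proof.
move=> fg df; have fgx : f x = g x := nbhs_singleton fg.
have /diff_locallyP[dfc dfE] := df.
have gE : g \o shift x = cst (g x) + 'd f x +o_ 0 id.
  apply/eqaddoP => e e0; have /eqaddoP /(_ e e0) := dfE.
  have fg0 : \forall h \near 0, f (h + x) = g (h + x).
    by move: fg; rewrite (near_shift 0 x) /=; apply: filterS => h; rewrite subr0.
  apply: filterS2 fg0 => h fgh.
  by rewrite /= !fctE /= fgh fgx.
by apply/diff_locallyP; rewrite (diff_unique dfc gE).
Qed.

(** [Ck] speaks of iterated derivatives of total functions, but the usual
    formulas for these derivatives hold only where the functions are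
    differentiable, that is on [U].  Since [U] is open, equality on [U] is
    enough to replace a derivative by its formula. *)
Lemma eq_Ck (W : normedModType R) (k : nat) (U : set V) (f g : V -> W) :
  open U -> (forall x, U x -> f x = g x) -> Ck k U f -> Ck k U g.
Proof.
move=> oU; elim: k f g => [|k IHk] f g fg.
  move=> fC x Ux; rewrite /prop_for /continuous_at -(fg x Ux).
  apply: cvg_trans (fC x Ux); apply: near_eq_cvg.
  by apply: filterS fg _; exact: open_nbhs_nbhs.
have fgn x : U x -> \near x, f x = g x.
  by move=> Ux; apply: filterS fg _; exact: open_nbhs_nbhs.
move=> [df Df]; split=> [x Ux|v].
  by apply: near_eq_differentiable (df x Ux); exact: fgn.
by apply: IHk (Df v) => x Ux; apply: near_eq_derive; exact: fgn.
Qed.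

Lemma Ck_pred (W : normedModType R) (k : nat) (U : set V) (f : V -> W) :
  Ck k.+1 U f -> Ck k U f.
Proof.
elim: k f => [|k IHk] f [df Df]; last by split=> // v; exact: IHk.
by move=> x Ux; apply: differentiable_continuous; exact: df.
Qed.

Lemma Ck_add (W : normedModType R) (k : nat) (U : set V) (f g : V -> W) :
  open U -> Ck k U f -> Ck k U g -> Ck k U (f + g).
Proof.
move=> oU; elim: k f g => [|k IHk] f g.
  by move=> fC gC x Ux; apply: continuousD; [exact: fC|exact: gC].
move=> [df Df] [dg Dg]; split=> [x Ux|v].
  by apply: differentiableD; [exact: df|exact: dg].
apply: eq_Ck oU _ (IHk _ _ (Df v) (Dg v)) => x Ux.
by rewrite deriveD //; apply: diff_derivable; [exact: df|exact: dg].
Qed.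

Lemma Ck_opp (W : normedModType R) (k : nat) (U : set V) (f : V -> W) :
  open U -> Ck k U f -> Ck k U (- f).
Proof.
move=> oU; elim: k f => [|k IHk] f.
  by move=> fC x Ux; apply: continuousN; exact: fC.
move=> [df Df]; split=> [x Ux|v].
  by apply: differentiableN; exact: df.
apply: eq_Ck oU _ (IHk _ (Df v)) => x Ux.
by rewrite deriveN //; apply: diff_derivable; exact: df.
Qed.

(** In the Leibniz formula each derivative is multiplied by an undifferentiated
    factor, to which the induction hypothesis applies by [Ck_pred]. *)
Lemma Ck_mul (k : nat) (U : set V) (f g : V -> R^o) :
  open U -> Ck k U f -> Ck k U g -> Ck k U (f * g : V -> R^o).
Proof.
move=> oU; elim: k f g => [|k IHk] f g.
  by move=> fC gC x Ux; apply: continuousM; [exact: fC|exact: gC].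
move=> Cf Cg; have [Cf' Cg'] := (Ck_pred Cf, Ck_pred Cg).
case: Cf Cg => [df Df] [dg Dg]; split=> [x Ux|v].
  by apply: differentiableM; [exact: df|exact: dg].
apply: eq_Ck oU _ (Ck_add oU (IHk _ _ Cf' (Dg v)) (IHk _ _ Cg' (Df v))) => x Ux.
by rewrite deriveM //; apply: diff_derivable; [exact: df|exact: dg].
Qed.
End SmoothFunctions.

(** * Linear algebra of bilinear forms in one tangent space *)

Section PointwiseAlgebra.
Context {R : realType} {n : nat}.
Implicit Types (a : 'cV[R]_n) (B : 'M[R]_n) (u v w : 'rV[R]_n).

Lemma pairingD a u v : pairing a (u + v) = pairing a u + pairing a v.
Proof. by rewrite /pairing mulmxDl mxE. Qed.

Lemma pairingZ a (t : R) u : pairing a (t *: u) = t * pairing a u.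
Proof. by rewrite /pairing -scalemxAl mxE. Qed.

Lemma pairingB a u v : pairing a (u - v) = pairing a u - pairing a v.
Proof. by rewrite pairingD -scaleN1r pairingZ mulN1r. Qed.

Lemma pairing_scale_form (t : R) a u : pairing (t *: a) u = t * pairing a u.
Proof. by rewrite /pairing -scalemxAr mxE. Qed.

Lemma pairing_delta (j : 'I_n) u : pairing (delta_mx j 0) u = u 0 j.
Proof.
rewrite /pairing mxE (bigD1 j) //= mxE !eqxx mulr1 big1 ?addr0 // => i /negPf ij.
by rewrite mxE ij mulr0.
Qed.

Lemma bilinDl B u v w : bilin B (u + v) w = bilin B u w + bilin B v w.
Proof. by rewrite /bilin !mulmxDl mxE. Qed.

Lemma bilinDr B u v w : bilin B u (v + w) = bilin B u v + bilin B u w.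
Proof. by rewrite /bilin linearD mulmxDr mxE. Qed.

Lemma bilinZl B (t : R) u v : bilin B (t *: u) v = t * bilin B u v.
Proof. by rewrite /bilin -!scalemxAl mxE. Qed.

Lemma bilinZr B (t : R) u v : bilin B u (t *: v) = t * bilin B u v.
Proof. by rewrite /bilin linearZ -scalemxAr mxE. Qed.

Lemma bilin_add_form B B' u v : bilin (B + B') u v = bilin B u v + bilin B' u v.
Proof. by rewrite /bilin mulmxDr mulmxDl mxE. Qed.

Lemma bilin_opp_form B u v : bilin (- B) u v = - bilin B u v.
Proof. by rewrite /bilin mulmxN mulNmx mxE. Qed.

Lemma bilin_square a u v : bilin (a *m a^T) u v = pairing a u * pairing a v.
Proof.
by rewrite /bilin /pairing mulmxA -mulmxA -trmx_mul mxE big_ord1 [X in _ * X]mxE.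
Qed.

Lemma bilin_delta B (i j : 'I_n) : bilin B (delta_mx 0 i) (delta_mx 0 j) = B i j.
Proof.
rewrite /bilin -rowE trmx_delta mxE (bigD1 j) //= !mxE !eqxx mulr1.
by rewrite big1 ?addr0 // => l /negPf lj; rewrite !mxE lj mulr0.
Qed.

Lemma bilin_inj B B' : (forall u v, bilin B u v = bilin B' u v) -> B = B'.
Proof. by move=> BB'; apply/matrixP => i j; rewrite -!bilin_delta. Qed.

(** The projection of [u] onto [ker a] along [w], when [pairing a w = 1]. *)
Definition horizontal a w u : 'rV[R]_n := u - pairing a u *: w.

Lemma horizontal_split a w u : u = horizontal a w u + pairing a u *: w.
Proof. by rewrite subrK. Qed.

Lemma pairing_horizontal a w u : pairing a w = 1 ->
  pairing a (horizontal a w u) = 0.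
Proof. by move=> aw; rewrite pairingB pairingZ aw mulr1 subrr. Qed.

Lemma bilin_split B a w u v : bilin B u v =
  bilin B (horizontal a w u) (horizontal a w v)
  + pairing a v * bilin B (horizontal a w u) w
  + pairing a u * bilin B w (horizontal a w v)
  + pairing a u * pairing a v * bilin B w w.
Proof.
rewrite [in LHS](horizontal_split a w u) [in LHS](horizontal_split a w v).
move: (horizontal _ _ u) (horizontal _ _ v) => u' v'.
by rewrite !(bilinDl, bilinDr, bilinZl, bilinZr) !mulrA !addrA.
Qed.

(** The four last hypotheses compare the blocks of [B] and [B'] for the
    splitting [T = ker a + span w]. *)
Lemma bilin_split_ext a w B B' : pairing a w = 1 ->
  (forall u v, pairing a u = 0 -> pairing a v = 0 ->
     bilin B u v = bilin B' u v) ->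
  (forall u, pairing a u = 0 -> bilin B u w = bilin B' u w) ->
  (forall v, pairing a v = 0 -> bilin B w v = bilin B' w v) ->
  bilin B w w = bilin B' w w -> B = B'.
Proof.
move=> aw DD Dw wD ww; apply: bilin_inj => u v.
have Dh z : pairing a (horizontal a w z) = 0 by exact: pairing_horizontal.
rewrite (bilin_split B a w) (bilin_split B' a w).
by rewrite (DD _ _ (Dh u) (Dh v)) (Dw _ (Dh u)) (wD _ (Dh v)) ww.
Qed.

End PointwiseAlgebra.

(** * Restriction to the contact distribution and extension by the Reeb field *)

Section RestrictionExtension.
Context {R : realType} {n : nat} {X : manifold R n}.
Implicit Types (eta : form1 X) (xi : vfield X) (g gt : tensor02 X).

(** The tensor [eta (x) eta]. *)
Definition square_form eta : tensor02 X := fun p => eta p *m (eta p)^T.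

Lemma square_formE eta p u v :
  bilin (square_form eta p) u v = pairing (eta p) u * pairing (eta p) v.
Proof. exact: bilin_square. Qed.

Lemma smooth_tensor02D g gt :
  smooth_tensor02 g -> smooth_tensor02 gt -> smooth_tensor02 (g \+ gt).
Proof.
move=> Sg Sgt c i j ac k.
have := Ck_add (@open_cimg _ _ _ c) (Sg c i j ac k) (Sgt c i j ac k).
by congr (Ck k _ _); apply/funext => x; rewrite /= bilin_add_form.
Qed.

Lemma smooth_tensor02N g : smooth_tensor02 g -> smooth_tensor02 (\- g).
Proof.
move=> Sg c i j ac k; have := Ck_opp (@open_cimg _ _ _ c) (Sg c i j ac k).
by congr (Ck k _ _); apply/funext => x; rewrite /= bilin_opp_form.
Qed.

Lemma smooth_square_form eta : smooth_form1 eta ->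
  smooth_tensor02 (square_form eta).
Proof.
move=> Seta c i j ac k.
have := Ck_mul (@open_cimg _ _ _ c) (Seta c i ac k) (Seta c j ac k).
by congr (Ck k _ _); apply/funext => x; rewrite /= square_formE.
Qed.

Section FixedReeb.
Context {eta : form1 X} {xi : vfield X}.
Hypothesis eta_xi : forall p, pairing (eta p) (xi p) = 1.

Lemma line_reeb p : line xi p (xi p).
Proof. by exists 1; rewrite scale1r. Qed.

Lemma restriction_unique gt g g' :
  restriction_of eta xi gt g -> restriction_of eta xi gt g' -> g = g'.
Proof.
move=> [_ adm eqD] [_ adm' eqD']; apply/funext => p.
apply: bilin_split_ext (eta_xi p) _ _ _ _ => [u v Du Dv|u Du|v Dv|].
- by rewrite eqD ?eqD'.
- by rewrite adm ?adm' //; right; exact: line_reeb.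
- by rewrite adm ?adm' //; left; exact: line_reeb.
- by rewrite adm ?adm' //; left; exact: line_reeb.
Qed.

Lemma extension_unique g gt gt' :
  extension_of eta xi g gt -> extension_of eta xi g gt' -> gt = gt'.
Proof.
move=> [_ sym eqD D0 xi1] [_ sym' eqD' D0' xi1']; apply/funext => p.
apply: bilin_split_ext (eta_xi p) _ _ _ _ => [u v Du Dv|u Du|v Dv|].
- by rewrite eqD ?eqD'.
- by rewrite D0 ?D0'.
- by rewrite sym sym' D0 ?D0'.
- by rewrite xi1 xi1'.
Qed.

Lemma add_square_extension g : smooth_form1 eta -> smooth_tensor02 g ->
  admissible02 xi g -> symmetric_tensor g ->
  extension_of eta xi g (g \+ square_form eta).
Proof.
move=> Seta Sg adm sym; split.
- exact: smooth_tensor02D (smooth_square_form Seta).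
- by move=> p u v; rewrite !bilin_add_form sym !square_formE [in LHS]mulrC.
- by move=> p u v Du _; rewrite bilin_add_form square_formE Du mul0r addr0.
- move=> p u Du; rewrite bilin_add_form square_formE Du mul0r addr0.
  by apply: adm; right; exact: line_reeb.
- move=> p; rewrite bilin_add_form square_formE eta_xi mulr1.
  by rewrite adm ?add0r //; left; exact: line_reeb.
Qed.

(** The last hypothesis says that [eta] is [gt]-dual to [xi]; this is what makes
    [gt - eta (x) eta] vanish along [xi]. *)
Lemma sub_square_restriction gt : smooth_form1 eta -> smooth_tensor02 gt ->
  symmetric_tensor gt ->
  (forall p u, bilin (gt p) u (xi p) = pairing (eta p) u) ->
  restriction_of eta xi gt (gt \- square_form eta).
Proof.
move=> Seta Sgt sym gt_xi.
have gxi p u : bilin ((gt \- square_form eta) p) u (xi p) = 0.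
  by rewrite bilin_add_form bilin_opp_form square_formE gt_xi eta_xi mulr1 subrr.
have gsym p u v : bilin ((gt \- square_form eta) p) u v
                = bilin ((gt \- square_form eta) p) v u.
  by rewrite !bilin_add_form !bilin_opp_form !square_formE sym mulrC.
split.
- exact: smooth_tensor02D (smooth_tensor02N (smooth_square_form Seta)).
- move=> p u v [] [t ->]; last by rewrite bilinZr gxi mulr0.
  by rewrite gsym bilinZr gxi mulr0.
- move=> p u v Du _.
  by rewrite bilin_add_form bilin_opp_form square_formE Du mul0r subr0.
Qed.

(** The defining blocks of an extension are those of [g + eta (x) eta]: on [D]
    the second term vanishes, and along [xi] the first one does. *)
Lemma extension_bilin g gt p u v :
  admissible02 xi g -> extension_of eta xi g gt ->
  bilin (gt p) u v = bilin (g p) u v + pairing (eta p) u * pairing (eta p) v.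
Proof.
move=> adm [_ sym eqD D0 xi1].
suff -> : gt p = g p + square_form eta p.
  by rewrite bilin_add_form square_formE.
apply: bilin_split_ext (eta_xi p) _ _ _ _ => [{}u {}v Du Dv|{}u Du|{}v Dv|];
  rewrite bilin_add_form square_formE.
- by rewrite eqD // Du mul0r addr0.
- by rewrite D0 // Du mul0r adm ?addr0 //; right; exact: line_reeb.
- by rewrite sym D0 // Dv mulr0 adm ?addr0 //; left; exact: line_reeb.
- by rewrite xi1 eta_xi mulr1 adm ?add0r //; left; exact: line_reeb.
Qed.

(** In the pseudo-Riemannian case nondegeneracy passes to [D] because its
    complement [span xi] is orthogonal to it: a vector of [D] orthogonal to
    [D] is orthogonal to everything. *)
Lemma fibre_metric_restrict k g gt p :
  (forall u v, Dker eta p u -> Dker eta p v ->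
     bilin (g p) u v = bilin (gt p) u v) ->
  (forall u, Dker eta p u -> bilin (gt p) u (xi p) = 0) ->
  fibre_metric k setT (gt p) -> fibre_metric k (Dker eta p) (g p).
Proof.
move=> eqD D0 [sym pos]; split=> [u v Du Dv|]; first by rewrite !eqD // sym.
case: k pos => [pos u Du u0|nondeg u Du ker_u]; first by rewrite eqD // pos.
apply: nondeg => // v _; rewrite (horizontal_split (eta p) (xi p) v).
have Dv : Dker eta p (horizontal (eta p) (xi p) v).
  exact: pairing_horizontal.
by rewrite bilinDr bilinZr D0 // mulr0 addr0 -eqD // ker_u.
Qed.

(** [D] and [xi] are [gt]-orthogonal and [gt (xi, xi) = 1].  Hence
    [gt (u, u) = g (u', u') + (eta u)^2] for the horizontal part [u'] of [u],
    which gives positivity.  In the pseudo-Riemannian case a vector in the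
    kernel of [gt] is orthogonal to [xi], hence lies in [D], where [g] is
    nondegenerate. *)
Lemma fibre_metric_extend k g gt p :
  admissible02 xi g -> extension_of eta xi g gt ->
  fibre_metric k (Dker eta p) (g p) -> fibre_metric k setT (gt p).
Proof.
move=> adm ext [_ pos]; have [_ sym eqD D0 xi1] := ext.
split=> [u v _ _|]; first exact: sym.
have Dh u : Dker eta p (horizontal (eta p) (xi p) u).
  exact: pairing_horizontal.
have gt_sq u : bilin (gt p) u u =
    bilin (g p) (horizontal (eta p) (xi p) u) (horizontal (eta p) (xi p) u)
    + pairing (eta p) u ^+ 2.
  rewrite (bilin_split _ (eta p) (xi p)) (eqD _ _ _ (Dh u) (Dh u)).
  by rewrite (sym _ (xi p)) (D0 _ _ (Dh u)) xi1 !mulr0 !addr0 mulr1.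
case: k pos => [pos u _ u0|nondeg u _ ker_u].
  (* One of the two summands of [gt_sq] is positive: the second one if [u] is
     vertical, the first one otherwise. *)
  rewrite gt_sq; have [h0|/eqP h0] := eqVneq (horizontal (eta p) (xi p) u) 0.
    rewrite h0 /bilin mul0mx mul0mx mxE add0r exprn_even_gt0 //=.
    apply/eqP => eu0; apply: u0.
    by rewrite (horizontal_split (eta p) (xi p) u) h0 eu0 scale0r addr0.
  by apply: ltr_wpDr; [exact: sqr_ge0|exact: pos].
have eu0 : pairing (eta p) u = 0.
  rewrite -(ker_u (xi p) I) (extension_bilin _ _ _ adm ext) eta_xi mulr1.
  by rewrite adm ?add0r //; right; exact: line_reeb.
by apply: nondeg => // v Dv; rewrite -eqD // ker_u.
Qed.

End FixedReeb.
End RestrictionExtension.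

(** * The two senses of an almost contact metric structure *)

Section OldAndNew.
Context {R : realType} {n : nat} {X : manifold R n}.
Context {k : metric_kind} {eta : form1 X} {xi : vfield X} {phi : tensor11 X}.

Lemma old_metric_symmetric gt : acm_old k phi xi eta gt -> symmetric_tensor gt.
Proof. by move=> old p u v; case: (old_metric old p) => sym _; exact: sym. Qed.

(** Compatibility for [u] and [xi] reads
    [0 = gt (phi u, phi xi) = gt (u, xi) - eta u]. *)
Lemma old_metric_reeb gt p u : acm_old k phi xi eta gt ->
  bilin (gt p) u (xi p) = pairing (eta p) u.
Proof.
move=> old; apply/esym/eqP; rewrite -subr_eq0 -oppr_eq0 opprB.
rewrite -[X in _ - X]mulr1 -(old_eta_xi old p) -(old_compat old).
by rewrite (old_phi_xi old) /bilin trmx0 mulmx0 mxE.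
Qed.

Lemma old_restriction gt : acm_old k phi xi eta gt ->
  restriction_of eta xi gt (gt \- square_form eta).
Proof.
move=> old; apply: (sub_square_restriction (old_eta_xi old)).
- exact: old_smooth_eta old.
- exact: old_smooth_metric old.
- exact: old_metric_symmetric.
- by move=> p u; exact: old_metric_reeb.
Qed.

Lemma old_extension_of_restriction gt g : acm_old k phi xi eta gt ->
  restriction_of eta xi gt g -> extension_of eta xi g gt.
Proof.
move=> old [_ _ eqD]; split.
- exact: old_smooth_metric old.
- exact: old_metric_symmetric.
- by move=> p u v Du Dv; rewrite eqD.
- by move=> p u Du; rewrite old_metric_reeb.
- by move=> p; rewrite old_metric_reeb // (old_eta_xi old).
Qed.

(** Symmetry of [g] on all of [T], and not only on [D], comes from the explicit
    formula for the restriction.  The identities of [phi] on [D] are those on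
    [T] with [eta u = 0]; note that [phi] preserves [D]. *)
Lemma old_to_new gt g : acm_old k phi xi eta gt ->
  restriction_of eta xi gt g -> acm_new k eta xi phi g.
Proof.
move=> old restr; have [Sg adm eqD] := restr.
have Dphi p u : Dker eta p (u *m phi p) by exact: (old_eta_phi old).
split=> //.
- exact: old_smooth_phi old.
- move=> p u a [[t ->]|[t ->]].
    by rewrite -scalemxAl (old_phi_xi old) scaler0 /pairing mul0mx mxE.
  by rewrite pairing_scale_form Dphi mulr0.
- rewrite (restriction_unique (old_eta_xi old) restr (old_restriction old)).
  move=> p u v; rewrite !bilin_add_form !bilin_opp_form !square_formE.
  by rewrite (old_metric_symmetric old) [in LHS]mulrC.
- move=> p; apply: (fibre_metric_restrict (old_eta_xi old) _ _ (old_metric old p)).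
    exact: eqD.
  by move=> u Du; rewrite (old_metric_reeb _ _ old).
- by move=> p u Du; rewrite (old_phi2 old) Du scale0r addr0.
- by move=> p u v Du Dv; rewrite !eqD // (old_compat old) Du mul0r subr0.
Qed.

(** Admissibility of [phi] gives that every covector vanishes on [phi xi]; the
    coordinate covectors suffice. *)
Lemma new_phi_reeb g p : acm_new k eta xi phi g -> xi p *m phi p = 0.
Proof.
move=> new; apply/rowP => j; rewrite -pairing_delta mxE.
by apply: (new_admissible_phi new); left; exact: line_reeb.
Qed.

Lemma new_eta_phi g p u : acm_new k eta xi phi g ->
  pairing (eta p) (u *m phi p) = 0.
Proof.
move=> new; apply: (new_admissible_phi new); right.
by exists 1; rewrite scale1r.
Qed.

(** [phi] and [g] do not see the [xi]-components, so the identities on [D],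
    applied to the horizontal parts, hold for all vectors up to the terms that
    the horizontal projection and [eta (x) eta] contribute. *)
Lemma new_to_old g gt : smooth_form1 eta -> is_reeb eta xi ->
  acm_new k eta xi phi g -> extension_of eta xi g gt ->
  acm_old k phi xi eta gt.
Proof.
move=> Seta reeb new ext; have [_ eta_xi _] := reeb.
have [Sgt _ _ _ _] := ext; have adm := new_admissible_metric new.
have phih p u : u *m phi p = horizontal (eta p) (xi p) u *m phi p.
  by rewrite mulmxBl -scalemxAl (new_phi_reeb p new) scaler0 subr0.
have Dh p u : Dker eta p (horizontal (eta p) (xi p) u).
  exact: pairing_horizontal.
have gh p u v : bilin (g p) u v =
    bilin (g p) (horizontal (eta p) (xi p) u) (horizontal (eta p) (xi p) v).
  have g_xi w : bilin (g p) w (xi p) = 0 by apply: adm; right; exact: line_reeb.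
  have xi_g w : bilin (g p) (xi p) w = 0 by apply: adm; left; exact: line_reeb.
  by rewrite (bilin_split _ (eta p) (xi p)) !(g_xi, xi_g) !mulr0 !addr0.
split=> //.
- exact: new_smooth_phi new.
- by move=> p; exact: (fibre_metric_extend eta_xi adm ext (new_metric new p)).
- by move=> p; exact: new_phi_reeb new.
- by move=> p u; exact: new_eta_phi new.
- by move=> p u; rewrite (phih p u) (new_phi2 new) // opprB addrC.
- move=> p u v; rewrite !(extension_bilin eta_xi _ _ _ adm ext).
  rewrite !(new_eta_phi p _ new) mul0r addr0 addrK.
  by rewrite (phih p u) (phih p v) (new_compat new) // -gh.
Qed.

End OldAndNew.

Theorem theorem6 (R : realType) (n : nat) (hn : odd n) (X : manifold R n)
    (k : metric_kind) (eta : form1 X) (heta : smooth_form1 eta)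
    (homega : forall p, nondegenerate_on (Dker eta p) (dform eta p))
    (xi : vfield X) (hxi : is_reeb eta xi) :
  [/\ (forall phi gt, acm_old k phi xi eta gt ->
         (exists! g, restriction_of eta xi gt g) /\
         (forall g, restriction_of eta xi gt g -> acm_new k eta xi phi g)),
      (forall phi g, acm_new k eta xi phi g ->
         (exists! gt, extension_of eta xi g gt) /\
         (forall gt, extension_of eta xi g gt -> acm_old k phi xi eta gt)),
      (forall phi gt g gt', acm_old k phi xi eta gt ->
         restriction_of eta xi gt g -> extension_of eta xi g gt' -> gt' = gt) &
      (forall phi g gt g', acm_new k eta xi phi g ->
         extension_of eta xi g gt -> restriction_of eta xi gt g' -> g' = g)].
Proof.
have [_ eta_xi _] := hxi; split.
- move=> phi gt old; split; last by move=> g; exact: old_to_new.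
  exists (gt \- square_form eta); split; first exact: old_restriction old.
  by move=> g; apply: (restriction_unique eta_xi); exact: old_restriction old.
- move=> phi g new; split; last by move=> gt; exact: new_to_old.
  have ext : extension_of eta xi g (g \+ square_form eta).
    by case: new => *; exact: add_square_extension.
  by exists (g \+ square_form eta); split=> // gt; exact: extension_unique.
- move=> phi gt g gt' old restr ext; apply: (extension_unique eta_xi ext).
  exact: old_extension_of_restriction old restr.
- move=> phi g gt g' new [_ _ eqD _ _] restr.
  apply: (restriction_unique eta_xi restr); split.
  + exact: new_smooth_metric new.
  + exact: new_admissible_metric new.
  + by move=> p u v Du Dv; rewrite eqD.
Qed.
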